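(* Let $\mathcal{M}^{m\sigma}$ be the set of all reflected maxmin copulas. Then every $C\in\mathcal{M}^{m\sigma}$ satisfies $\mu_\infty(C)\le 3-2\sqrt2$, and the bound is attained by some reflected maxmin copula, i.e. $\mu_\infty(\mathcal{M}^{m\sigma}):=\sup_{C\in\mathcal{M}^{m\sigma}}\mu_\infty(C)=3-2\sqrt2$. The maximal asymmetry function $d^*_{\mathcal{M}^{m\sigma}}(x,y)=\sup_{C\in\mathcal{M}^{m\sigma}}|C(x,y)-C(y,x)|$ is given for $x,y\in[0,1]$ by $$d^*_{\mathcal{M}^{m\sigma}}(x,y)=\begin{cases}\frac{x}{y}(y-x); & \text{if } y(1-y)\le x\le\min\{y,1-y\},\\ \frac{1-y}{y}(y-x); & \text{if } 1-y\le x\le y,\\ xy; & \text{if } x\le y(1-y)\text{ or } y\le x(1-x),\\ \frac{y}{x}(x-y); & \text{if } x(1-x)\le y\le\min\{x,1-x\},\\ \frac{1-x}{x}(x-y); & \text{if } 1-x\le y\le x.\end{cases}$$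
   Context: A (bivariate) copula is a function $C:[0,1]^2\to[0,1]$ such that $C(x,0)=0=C(0,y)$, $C(x,1)=x$, $C(1,y)=y$ for all $x,y\in[0,1]$, and $C(x_2,y_2)-C(x_2,y_1)-C(x_1,y_2)+C(x_1,y_1)\ge 0$ whenever $0\le x_1\le x_2\le1$ and $0\le y_1\le y_2\le 1$. For a copula $C$, $\mu_\infty(C)=\max_{x,y\in[0,1]}|C(x,y)-C(y,x)|$. Let $\mathcal{F}$ be the set of functions $f:[0,1]\to[0,1]$ such that $f(0)=f(1)=0$, $f(x)+x$ is nondecreasing on $[0,1]$, and $f(x)/x$ is nonincreasing on $(0,1]$. A reflected maxmin copula is a copula of the form $C(x,y)=\max\{0,\ xy-f(x)g(y)\}$ with $f,g\in\mathcal{F}$ (it is known that every such function is a copula). In the piecewise formula, overlapping cases give the same value; at $(0,0)$ the value is $0$. *)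

(* Defs.v *)
From HB Require Import structures.
From mathcomp Require Import all_boot all_order all_algebra.
From mathcomp Require Import all_classical all_reals all_analysis.
From mathcomp Require Import lra.

Set Implicit Arguments.
Unset Strict Implicit.
Unset Printing Implicit Defensive.

Import Order.TTheory GRing.Theory Num.Theory.
Import numFieldNormedType.Exports.

Local Open Scope classical_set_scope.
Local Open Scope ring_scope.

(* Functions on [0,1] and [0,1]^2 are encoded as total functions on R and
   R x R; only their values on [0,1] and [0,1]^2 are ever constrained or used. *)

Definition unit_itv (R : realType) : set R := `[0, 1]%classic.

Record is_copula (R : realType) (C : R -> R -> R) : Prop := IsCopula {
  copula_range : forall x y, unit_itv x -> unit_itv y -> unit_itv (C x y);
  copula_x0 : forall x, unit_itv x -> C x 0 = 0;
  copula_0y : forall y, unit_itv y -> C 0 y = 0;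
  copula_x1 : forall x, unit_itv x -> C x 1 = x;
  copula_1y : forall y, unit_itv y -> C 1 y = y;
  copula_2increasing : forall x1 x2 y1 y2,
    0 <= x1 -> x1 <= x2 -> x2 <= 1 -> 0 <= y1 -> y1 <= y2 -> y2 <= 1 ->
    0 <= C x2 y2 - C x2 y1 - C x1 y2 + C x1 y1 }.

(* For a copula this supremum is a maximum: see mu_infty_max below. *)
Definition mu_infty (R : realType) (C : R -> R -> R) : R :=
  sup [set r | exists x y,
    [/\ unit_itv x, unit_itv y & r = `|C x y - C y x|]].

Definition mu_infty_class (R : realType) (M : set (R -> R -> R)) : R :=
  sup [set mu_infty C | C in M].

Definition dstar (R : realType) (M : set (R -> R -> R)) (x y : R) : R :=
  sup [set `|C x y - C y x| | C in M].

Record in_F (R : realType) (f : R -> R) : Prop := InF {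
  F_range : forall x, unit_itv x -> unit_itv (f x);
  F_0 : f 0 = 0;
  F_1 : f 1 = 0;
  F_add_nondecreasing : forall x1 x2,
    0 <= x1 -> x1 <= x2 -> x2 <= 1 -> f x1 + x1 <= f x2 + x2;
  F_div_nonincreasing : forall x1 x2,
    0 < x1 -> x1 <= x2 -> x2 <= 1 -> f x2 / x2 <= f x1 / x1 }.

Definition reflected_maxmin (R : realType) : set (R -> R -> R) :=
  [set C | is_copula C /\
    exists f g, [/\ in_F f, in_F g &
      forall x y, unit_itv x -> unit_itv y ->
        C x y = Num.max 0 (x * y - f x * g y)]].
Arguments reflected_maxmin : clear implicits.

Lemma copula_lipschitz (R : realType) (C : R -> R -> R) (x1 y1 x2 y2 : R) :
  is_copula C -> unit_itv x1 -> unit_itv y1 -> unit_itv x2 -> unit_itv y2 ->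
  `|C x1 y1 - C x2 y2| <= `|x1 - x2| + `|y1 - y2|.
Proof.
move=> cC.
have Lx a b y : unit_itv a -> unit_itv b -> unit_itv y ->
    `|C a y - C b y| <= `|a - b|.
  wlog ab : a b / a <= b.
    move=> H ua ub uy; have [ab|ba] := leP a b; first exact: H.
    by rewrite distrC (distrC a); apply: H => //; exact: ltW.
  move=> ua ub uy; move: (ua) (ub) (uy); rewrite /unit_itv /= !in_itv /=.
  move=> /andP[a0 a1] /andP[b0 b1] /andP[y0 yl].
  have := copula_2increasing cC a0 ab b1 (lexx 0) y0 yl.
  have := copula_2increasing cC a0 ab b1 y0 yl (lexx 1).
  rewrite (copula_x0 cC ua) (copula_x0 cC ub) (copula_x1 cC ua) (copula_x1 cC ub).
  move=> h1 h2; rewrite distrC (distrC a) !ger0_norm; lra.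
have Ly a b x : unit_itv a -> unit_itv b -> unit_itv x ->
    `|C x a - C x b| <= `|a - b|.
  wlog ab : a b / a <= b.
    move=> H ua ub ux; have [ab|ba] := leP a b; first exact: H.
    by rewrite distrC (distrC a); apply: H => //; exact: ltW.
  move=> ua ub ux; move: (ua) (ub) (ux); rewrite /unit_itv /= !in_itv /=.
  move=> /andP[a0 a1] /andP[b0 b1] /andP[x0 xl].
  have := copula_2increasing cC (lexx 0) x0 xl a0 ab b1.
  have := copula_2increasing cC x0 xl (lexx 1) a0 ab b1.
  rewrite (copula_0y cC ua) (copula_0y cC ub) (copula_1y cC ua) (copula_1y cC ub).
  move=> h1 h2; rewrite distrC (distrC a) !ger0_norm; lra.
move=> ux1 uy1 ux2 uy2.
have -> : C x1 y1 - C x2 y2 = (C x1 y1 - C x2 y1) + (C x2 y1 - C x2 y2) by lra.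
by apply: (le_trans (ler_normD _ _)); apply: lerD; [exact: Lx|exact: Ly].
Qed.

Lemma mu_infty_max (R : realType) (C : R -> R -> R) : is_copula C ->
  (exists x y, [/\ unit_itv x, unit_itv y & mu_infty C = `|C x y - C y x|]) /\
  (forall x y, unit_itv x -> unit_itv y -> `|C x y - C y x| <= mu_infty C).
Proof.
move=> cC; pose A : set (R * R) := @unit_itv R `*` @unit_itv R.
pose h (p : R * R) : R := `|C p.1 p.2 - C p.2 p.1|.
have u0 : unit_itv (0 : R) by rewrite /unit_itv /= in_itv /= lexx ler01.
have A0 : A !=set0 by exists (0, 0).
have cA : compact A by apply: compact_setX; exact: segment_compact.
have hc : {within A, continuous h}.
  apply/subspace_continuousP => p [p1 p2]; apply/cvgrPdist_le => e e0.
  have e4 : 0 < e / 4 by lra.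
  rewrite near_withinE; near=> q => -[q1 q2].
  have d1 : `|p.1 - q.1| <= e / 4.
    near: q.
    have /cvgrPdist_le : fst q @[q --> p] --> p.1 by exact: cvg_fst.
    exact.
  have d2 : `|p.2 - q.2| <= e / 4.
    near: q.
    have /cvgrPdist_le : snd q @[q --> p] --> p.2 by exact: cvg_snd.
    exact.
  apply: (le_trans (ler_dist_dist _ _)).
  have -> : C p.1 p.2 - C p.2 p.1 - (C q.1 q.2 - C q.2 q.1) =
    (C p.1 p.2 - C q.1 q.2) - (C p.2 p.1 - C q.2 q.1) by lra.
  apply: (le_trans (ler_normB _ _)).
  have := copula_lipschitz cC p1 p2 q1 q2.
  have := copula_lipschitz cC p2 p1 q2 q1.
  by move: d1 d2; lra.
have [c cA' cmax] := compact_EVT_max A0 cA hc.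
have [c1 c2] : A c by move: cA'; rewrite inE.
have E : mu_infty C = h c.
  apply/eqP; rewrite eq_le; apply/andP; split.
    apply: ge_sup; first by exists (h c), c.1, c.2.
    by move=> _ [x [y [ux uy ->]]]; apply: (cmax (x, y)); rewrite inE.
  apply: ub_le_sup; last by exists c.1, c.2.
  by exists (h c) => _ [x [y [ux uy ->]]]; apply: (cmax (x, y)); rewrite inE.
split; first by exists c.1, c.2.
by move=> x y ux uy; rewrite E; apply: (cmax (x, y)); rewrite inE.
Unshelve. all: by end_near.
Qed.

(* Main.v *)
(** For x <= y, the conditions on F give f(x) >= f(y) x/y and
    g(y) >= g(x) + x - y, together with f(y) <= 1 - y and g(x) <= 1 - x.
    Inserting them into C(x,y) - C(y,x) bounds it by xy, by (x/y)(y-x) and by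
    ((1-y)/y)(y-x).  The smallest of the three is attained by the tent functions
    t |-> max(0, min(p t, s - t)), which are extremal for these inequalities at
    x and y.  For the global bound, (1-u)(2u-1)/u <= 3 - 2 sqrt 2 is the AM-GM
    inequality 2u + 1/u >= 2 sqrt 2, with equality at u = sqrt 2 / 2. *)

Require Import Defs.
From HB Require Import structures.
From mathcomp Require Import all_boot all_order all_algebra.
From mathcomp Require Import all_classical all_reals all_analysis.
From mathcomp Require Import ring lra.

Set Implicit Arguments.
Unset Strict Implicit.

Import Order.TTheory GRing.Theory Num.Theory.
Import numFieldNormedType.Exports.

Local Open Scope classical_set_scope.
Local Open Scope ring_scope.

(** * Preliminaries on suprema and on the class [in_F] *)

Lemma unit_itvE (R : realType) (x : R) : unit_itv x = (0 <= x <= 1) :> Prop.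
Proof. by rewrite /unit_itv /= in_itv. Qed.

Lemma sup_eq_max (R : realType) (A : set R) (m : R) :
  A m -> ubound A m -> sup A = m.
Proof.
move=> Am ubm; apply/eqP; rewrite eq_le; apply/andP; split.
  by apply: ge_sup => //; exists m.
by apply: ub_le_sup => //; exists m.
Qed.

(** Clearing denominators in the ratio condition extends it to [x1 = 0], where [f] vanishes. *)
Lemma F_cross (R : realType) (f : R -> R) (x1 x2 : R) : in_F f ->
  0 <= x1 -> x1 <= x2 -> x2 <= 1 -> f x2 * x1 <= f x1 * x2.
Proof.
move=> Ff; rewrite le_eqVlt => /predU1P[<- _ _|x10 x12 x21].
  by rewrite (F_0 Ff) mulr0 mul0r.
have x20 : 0 < x2 by exact: lt_le_trans x12.
have := F_div_nonincreasing Ff x10 x12 x21.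
by rewrite ler_pdivrMr // mulrAC ler_pdivlMr.
Qed.

Lemma F_ge0 (R : realType) (f : R -> R) (x : R) : in_F f ->
  0 <= x -> x <= 1 -> 0 <= f x.
Proof.
move=> Ff x0 x1; have ux : unit_itv x by rewrite unit_itvE x0.
by have := F_range Ff ux; rewrite unit_itvE => /andP[].
Qed.

Lemma F_le1B (R : realType) (f : R -> R) (x : R) : in_F f ->
  0 <= x -> x <= 1 -> f x <= 1 - x.
Proof.
move=> Ff x0 x1; have := F_add_nondecreasing Ff x0 x1 (lexx 1).
by rewrite (F_1 Ff); lra.
Qed.

(** * Reflected maxmin functions are copulas *)

Definition maxmin_fun (R : realType) (f g : R -> R) (x y : R) : R :=
  Num.max 0 (x * y - f x * g y).

Section Copula.
Variable R : realType.
Implicit Types f g : R -> R.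

Lemma maxmin_funC f g (x y : R) : maxmin_fun f g x y = maxmin_fun g f y x.
Proof. by rewrite /maxmin_fun mulrC (mulrC (f x)). Qed.

Lemma maxmin_fun_ge0 f g (x y : R) : 0 <= maxmin_fun f g x y.
Proof. by rewrite /maxmin_fun le_max lexx. Qed.

(** For [x > 0], [x * y - f x * g y] is [x] times [y - (f x / x) * g y]. The second factor is
    nondecreasing in [x], so where the product is positive it grows with [x]. *)
Lemma maxmin_fun_homo f g (x1 x2 y : R) : in_F f -> in_F g ->
  0 <= x1 -> x1 <= x2 -> x2 <= 1 -> 0 <= y -> y <= 1 ->
  maxmin_fun f g x1 y <= maxmin_fun f g x2 y.
Proof.
move=> Ff Fg x10 x12 x21 y0 y1.
have g0 := F_ge0 Fg y0 y1.
have fx := F_cross Ff x10 x12 x21.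
rewrite {1}/maxmin_fun ge_max maxmin_fun_ge0 /=.
rewrite /maxmin_fun le_max; apply/orP.
have [|Hpos] := leP (x1 * y - f x1 * g y) 0; [by left|right].
have x1p : 0 < x1.
  rewrite lt_neqAle x10 andbT; apply/eqP => x1E.
  by move: Hpos; rewrite -x1E (F_0 Ff); lra.
rewrite -(ler_pM2l x1p).
have := mulr_ge0 g0 (_ : 0 <= f x1 * x2 - f x2 * x1).
rewrite subr_ge0 => /(_ fx).
have := mulr_ge0 (_ : 0 <= x2 - x1) (ltW Hpos).
by rewrite subr_ge0 => /(_ x12); lra.
Qed.

(** The hypotheses confine [a2 - a1] between [-(x2 - x1)] and [(a1 / x1) * (x2 - x1)], and likewise
    for [b]. Two nonnegative increments are handled by the upper bounds and [a1 * b1 <= x1 * y1],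
    two negative ones by the lower bounds, and opposite signs give a nonpositive product. *)
Lemma increment_mul_le (x1 x2 y1 y2 a1 a2 b1 b2 : R) :
  0 < x1 -> x1 <= x2 -> 0 < y1 -> y1 <= y2 ->
  0 <= a1 -> 0 <= b1 -> a1 + x1 <= a2 + x2 -> b1 + y1 <= b2 + y2 ->
  a2 * x1 <= a1 * x2 -> b2 * y1 <= b1 * y2 -> a1 * b1 <= x1 * y1 ->
  (a2 - a1) * (b2 - b1) <= (x2 - x1) * (y2 - y1).
Proof.
move=> x1p x12 y1p y12 a10 b10 ax ayy ca cb ab.
have [a12|a21] := leP a1 a2; have [b12|b21] := leP b1 b2.
- have xy : 0 < x1 * y1 by rewrite mulr_gt0.
  rewrite -(ler_pM2l xy).
  have -> : x1 * y1 * ((a2 - a1) * (b2 - b1)) =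
            (x1 * (a2 - a1)) * (y1 * (b2 - b1)) by ring.
  apply: (@le_trans _ _ ((a1 * (x2 - x1)) * (b1 * (y2 - y1)))).
    by apply: ler_pM; rewrite ?mulr_ge0 ?subr_ge0 ?(ltW x1p) ?(ltW y1p) //; lra.
  have -> : a1 * (x2 - x1) * (b1 * (y2 - y1)) =
            a1 * b1 * ((x2 - x1) * (y2 - y1)) by ring.
  by apply: ler_wpM2r => //; rewrite mulr_ge0 ?subr_ge0.
- apply: (@le_trans _ _ 0); last by rewrite mulr_ge0 ?subr_ge0.
  by apply: mulr_ge0_le0; lra.
- apply: (@le_trans _ _ 0); last by rewrite mulr_ge0 ?subr_ge0.
  by apply: mulr_le0_ge0; lra.
- rewrite -mulrNN; apply: ler_pM; lra.
Qed.

(** If the value at one of the mixed corners is zero, monotonicity suffices. Otherwise both mixed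
    corners are unclipped, and the claim reduces to comparing the increments of [f] and [g] with
    those of the coordinates. *)
Lemma maxmin_fun_2increasing f g (x1 x2 y1 y2 : R) : in_F f -> in_F g ->
  0 <= x1 -> x1 <= x2 -> x2 <= 1 -> 0 <= y1 -> y1 <= y2 -> y2 <= 1 ->
  maxmin_fun f g x2 y1 + maxmin_fun f g x1 y2
    <= maxmin_fun f g x2 y2 + maxmin_fun f g x1 y1.
Proof.
move=> Ff Fg x10 x12 x21 y10 y12 y21.
have x20 := le_trans x10 x12; have y20 := le_trans y10 y12.
have x11 := le_trans x12 x21; have y11 := le_trans y12 y21.
have homox (y : R) : 0 <= y -> y <= 1 ->
    maxmin_fun f g x1 y <= maxmin_fun f g x2 y.
  exact: maxmin_fun_homo.
have homoy (x : R) : 0 <= x -> x <= 1 ->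
    maxmin_fun f g x y1 <= maxmin_fun f g x y2.
  by move=> x0 xl; rewrite !(maxmin_funC f); exact: maxmin_fun_homo.
have pos := @maxmin_fun_ge0 f g.
have [z21|p21] := leP (maxmin_fun f g x2 y1) 0.
  by have := homox _ y20 y21; have := pos x1 y1; lra.
have [z12|p12] := leP (maxmin_fun f g x1 y2) 0.
  by have := homoy _ x20 x21; have := pos x1 y1; lra.
have f1 := F_ge0 Ff x10 x11; have g1 := F_ge0 Fg y10 y11.
have f2 := F_ge0 Ff x20 x21; have g2 := F_ge0 Fg y20 y21.
have h21 : 0 < x2 * y1 - f x2 * g y1.
  by move: p21; rewrite lt_max ltxx.
have h12 : 0 < x1 * y2 - f x1 * g y2.
  by move: p12; rewrite lt_max ltxx.
have x1p : 0 < x1.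
  rewrite lt_neqAle x10 andbT; apply/eqP => x1E.
  by move: h12; rewrite -x1E (F_0 Ff); lra.
have y1p : 0 < y1.
  rewrite lt_neqAle y10 andbT; apply/eqP => y1E.
  by move: h21; rewrite -y1E (F_0 Fg); lra.
have fx := F_add_nondecreasing Ff x10 x12 x21.
have gy := F_add_nondecreasing Fg y10 y12 y21.
have fc := F_cross Ff x10 x12 x21.
have gc := F_cross Fg y10 y12 y21.
have H22 : x2 * y2 - f x2 * g y2 <= maxmin_fun f g x2 y2.
  by rewrite le_max lexx orbT.
have -> : maxmin_fun f g x2 y1 = x2 * y1 - f x2 * g y1.
  by apply/max_idPr; exact: ltW.
have -> : maxmin_fun f g x1 y2 = x1 * y2 - f x1 * g y2.
  by apply/max_idPr; exact: ltW.
have [h11|h11] := leP 0 (x1 * y1 - f x1 * g y1).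
  have H11 : x1 * y1 - f x1 * g y1 <= maxmin_fun f g x1 y1.
    by rewrite le_max lexx orbT.
  have : (f x2 - f x1) * (g y2 - g y1) <= (x2 - x1) * (y2 - y1).
    by apply: increment_mul_le => //; lra.
  by lra.
(* Lowering [f x1] to [a] puts the corner (x1, y1) on the zero set and only
   increases the value at (x1, y2). *)
have g1p : 0 < g y1.
  rewrite lt_neqAle g1 andbT; apply/eqP => gE.
  by move: h11; rewrite -gE; have := mulr_ge0 x10 y10; lra.
pose a := x1 * y1 / g y1.
have ag : a * g y1 = x1 * y1 by rewrite /a divfK // gt_eqF.
have a0 : 0 <= a by rewrite divr_ge0 ?mulr_ge0.
have af : a <= f x1 by rewrite ler_pdivrMr //; lra.
have : (f x2 - a) * (g y2 - g y1) <= (x2 - x1) * (y2 - y1).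
  apply: increment_mul_le => //; [lra| |lra].
  (* The ratio condition survives the replacement of [f x1] by [a]: it then says
     [f x2 * g y1 <= x2 * y1], which is [h21]. *)
  rewrite /a mulrAC ler_pdivlMr //.
  have := mulr_ge0 x10 (ltW h21); lra.
have : a * g y2 <= f x1 * g y2 by rewrite ler_wpM2r.
by have := pos x1 y1; lra.
Qed.

Lemma maxmin_fun_copula f g : in_F f -> in_F g -> is_copula (maxmin_fun f g).
Proof.
move=> Ff Fg; split.
- move=> x y; rewrite !unit_itvE => /andP[x0 x1] /andP[y0 y1].
  rewrite maxmin_fun_ge0 /= ge_max ler01 /=.
  have := mulr_ge0 (F_ge0 Ff x0 x1) (F_ge0 Fg y0 y1).
  by have := mulr_ile1 x0 y0 x1 y1; lra.
- by move=> x _; rewrite /maxmin_fun (F_0 Fg) !mulr0 subr0 maxxx.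
- by move=> y _; rewrite /maxmin_fun (F_0 Ff) !mul0r subr0 maxxx.
- move=> x; rewrite unit_itvE => /andP[x0 _].
  by rewrite /maxmin_fun (F_1 Fg) mulr1 mulr0 subr0; apply/max_idPr.
- move=> y; rewrite unit_itvE => /andP[y0 _].
  by rewrite /maxmin_fun (F_1 Ff) mul1r mul0r subr0; apply/max_idPr.
- move=> x1 x2 y1 y2 x10 x12 x21 y10 y12 y21.
  have := maxmin_fun_2increasing Ff Fg x10 x12 x21 y10 y12 y21.
  by lra.
Qed.

Lemma maxmin_fun_reflected f g :
  in_F f -> in_F g -> reflected_maxmin R (maxmin_fun f g).
Proof. by move=> Ff Fg; split; [exact: maxmin_fun_copula|exists f, g]. Qed.

(** * Upper bounds for the asymmetry at a point *)

Lemma maxmin_fun_asym_le f g (x y : R) : in_F f -> in_F g ->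
  0 <= x -> x <= y -> 0 < y -> y <= 1 ->
  [/\ maxmin_fun f g x y - maxmin_fun f g y x <= x * y,
      maxmin_fun f g x y - maxmin_fun f g y x <= x / y * (y - x) &
      maxmin_fun f g x y - maxmin_fun f g y x <= (1 - y) / y * (y - x)].
Proof.
move=> Ff Fg x0 xy yp y1.
have y0 := ltW yp; have x1 := le_trans xy y1.
have fx0 := F_ge0 Ff x0 x1; have gx0 := F_ge0 Fg x0 x1.
have fy0 := F_ge0 Ff y0 y1; have gy0 := F_ge0 Fg y0 y1.
have fc := F_cross Ff x0 xy y1.
have gd := F_add_nondecreasing Fg x0 xy y1.
have fy1 := F_le1B Ff y0 y1; have gx1 := F_le1B Fg x0 x1.
have pos := maxmin_fun_ge0 f g y x.
have Hyx : y * x - f y * g x <= maxmin_fun f g y x by rewrite le_max lexx orbT.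
have xy0 : 0 <= x * y by rewrite mulr_ge0.
have d0 : 0 <= y - x by rewrite subr_ge0.
have B1 : 0 <= x / y * (y - x) by rewrite mulr_ge0 ?divr_ge0.
have B2 : 0 <= (1 - y) / y * (y - x) by rewrite mulr_ge0 ?divr_ge0 ?subr_ge0.
rewrite {1 3 5}/maxmin_fun.
have [h|h] := leP (x * y - f x * g y) 0; first by split; lra.
have fg0 := mulr_ge0 fx0 gy0.
(* This bounds [f x * g y] below through [f y] and [g x], the only values entering at [(y, x)]. The
   factor [g x + x - y] may be negative, so it is replaced by [g y] before [f y * x] is enlarged. *)
have key : f y * x * (g x + x - y) <= f x * y * g y.
  apply: (@le_trans _ _ (f y * x * g y)); last by apply: ler_wpM2r.
  by apply: ler_wpM2l; [rewrite mulr_ge0|lra].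
have k1 := mulr_ge0 (mulr_ge0 x0 d0) (_ : 0 <= 1 - y - f y).
have {}k1 : 0 <= x * (y - x) * (1 - y - f y) by apply: k1; lra.
split; first lra.
- rewrite mulrAC ler_pdivlMr //.
  (* As a function of [f y * g x], the resulting bound increases until the value at [(y, x)] is
     clipped to 0 and decreases afterwards. Its maximum, at [f y * g x = x * y], is the claimed
     one. *)
  have [b|b] := leP (f y * g x) (x * y).
    have := mulr_ge0 d0 (_ : 0 <= x * y - f y * g x).
    have := mulr_ge0 y0 (_ : 0 <= maxmin_fun f g y x - (y * x - f y * g x)).
    by rewrite !subr_ge0 => /(_ Hyx) ? /(_ b) ?; lra.
  have := mulr_ge0 x0 (_ : 0 <= f y * g x - x * y).
  have := mulr_ge0 y0 pos.
  by rewrite subr_ge0 => ? /(_ (ltW b)) ?; lra.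
- rewrite mulrAC ler_pdivlMr //.
  (* Here [y] times the difference is at most [(y - x) * f y * (g x + x)], where [g x + x <= 1] and
     [f y <= 1 - y]. *)
  have := mulr_ge0 y0 (_ : 0 <= maxmin_fun f g y x - (y * x - f y * g x)).
  have := mulr_ge0 (mulr_ge0 fy0 d0) (_ : 0 <= 1 - x - g x).
  have := mulr_ge0 d0 (_ : 0 <= 1 - y - f y).
  by rewrite !subr_ge0 => /(_ fy1) ? /(_ gx1) ? /(_ Hyx) ?; lra.
Qed.

(** Exchanging [f] and [g] transposes the copula and flips the sign of the difference, so the
    one-sided bounds control the absolute value. *)
Lemma reflected_asym_le (C : R -> R -> R) (x y : R) : reflected_maxmin R C ->
  0 <= x -> x <= y -> 0 < y -> y <= 1 ->
  [/\ `|C x y - C y x| <= x * y,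
      `|C x y - C y x| <= x / y * (y - x) &
      `|C x y - C y x| <= (1 - y) / y * (y - x)].
Proof.
move=> [_ [f [g [Ff Fg CE]]]] x0 xy yp y1.
have ux : unit_itv x by rewrite unit_itvE x0 (le_trans xy).
have uy : unit_itv y by rewrite unit_itvE ltW.
have -> : C x y = maxmin_fun f g x y by exact: CE.
have -> : C y x = maxmin_fun f g y x by exact: CE.
have [a1 a2 a3] := maxmin_fun_asym_le Ff Fg x0 xy yp y1.
have [] := maxmin_fun_asym_le Fg Ff x0 xy yp y1.
rewrite !(maxmin_funC g) => b1 b2 b3.
by split; rewrite ler_norml; apply/andP; split; lra.
Qed.

(** * Tent functions and attainment of the bounds *)

(** Along the rising side the ratio to [t] is constant, along the falling side the sum with [t] is;
    each makes one condition of [in_F] an equality. *)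
Definition tent (p s t : R) : R := Num.max 0 (Num.min (p * t) (s - t)).

Lemma in_F_tent (p s : R) : 0 <= p -> 0 <= s -> s <= 1 -> in_F (tent p s).
Proof.
move=> p0 s0 s1; rewrite /tent; split.
- move=> x; rewrite !unit_itvE le_max lexx /= => /andP[x0 x1].
  by rewrite ge_max ler01 ge_min; apply/orP; right; lra.
- by apply/max_idPl; rewrite mulr0 ge_min lexx.
- by apply/max_idPl; rewrite ge_min; apply/orP; right; lra.
- move=> x1 x2 x10 x12 x21.
  have := ler_wpM2l p0 x12.
  by rewrite /Num.max /Num.min; do !case: ifPn; rewrite -?leNgt; lra.
- move=> x1 x2 x1p x12 x21.
  have x2p := lt_le_trans x1p x12.
  rewrite ler_pdivrMr // mulrAC ler_pdivlMr //.
  rewrite !(maxr_pMl, minr_pMl) ?(ltW x1p) ?(ltW x2p) // !mul0r.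
  have := mulr_ge0 s0 (_ : 0 <= x2 - x1); rewrite subr_ge0 => /(_ x12) sx.
  rewrite ge_max !le_max lexx /=; apply/orP; right.
  by rewrite le_min !ge_min; apply/andP; split; apply/orP; [left|right]; lra.
Qed.

Lemma tentl (p s t : R) : 0 <= p * t -> p * t <= s - t -> tent p s t = p * t.
Proof. by move=> pt st; rewrite /tent (min_idPl st); apply/max_idPr. Qed.

Lemma tentr (p s t : R) : s - t <= p * t -> tent p s t = Num.max 0 (s - t).
Proof. by move=> st; rewrite /tent (min_idPr st). Qed.

(* The slope of [g] makes [f y * g x = x * y], so that [C y x = 0]. *)
Lemma asym_attained_low (x y : R) : 0 < x -> x <= y -> x <= 1 - y ->
  exists2 C, reflected_maxmin R C &
    C x y - C y x = if x <= y * (1 - y) then x * y else x / y * (y - x).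
Proof.
move=> xp xy xy1.
have yp := lt_le_trans xp xy; have zp := lt_le_trans xp xy1.
(* The first tent peaks at [y] with the maximal height [1 - y]. The second peaks at [x], because
   [y * r + 1 = r], and falls to zero at [x * r], which is at most 1 as [x <= 1 - y]. *)
pose q := (1 - y) / y; pose r := (1 - y)^-1.
have qy : q * y = 1 - y by rewrite divfK // gt_eqF.
have r1 : r * (1 - y) = 1 by rewrite mulVf // gt_eqF.
have q0 : 0 <= q by rewrite divr_ge0 ?ltW.
have rp : 0 < r by rewrite invr_gt0.
have r0 := ltW rp.
have xr0 : 0 <= x * r by rewrite mulr_ge0 // ltW.
have xr1 : x * r <= 1 by rewrite -r1 mulrC ler_pM2l.
have yr0 : 0 <= y * r by rewrite mulr_ge0 // ltW.
have Ff : in_F (tent q 1) by exact: in_F_tent.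
have Fg : in_F (tent (y * r) (x * r)) by exact: in_F_tent.
exists (maxmin_fun (tent q 1) (tent (y * r) (x * r))).
  exact: maxmin_fun_reflected.
have fy : tent q 1 y = 1 - y by rewrite tentl ?qy // ltW.
have fx : tent q 1 x = q * x.
  apply: tentl; first by rewrite mulr_ge0 // ltW.
  by have := ler_wpM2l q0 xy; lra.
have e : x * r - x * r * y = x by have := congr1 ( *%R x) r1; lra.
have er : x * r - y = r * (x - y * (1 - y)).
  by have := congr1 ( *%R y) r1; lra.
have gx : tent (y * r) (x * r) x = y * r * x.
  by apply: tentl; [rewrite mulr_ge0 // ltW|lra].
have gy : tent (y * r) (x * r) y = Num.max 0 (x * r - y).
  apply: tentr.
  rewrite er (_ : y * r * y = r * (y * y)); last ring.
  by rewrite ler_pM2l //; lra.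
rewrite /maxmin_fun fx fy gx gy.
have -> : y * x - (1 - y) * (y * r * x) = 0.
  by have := congr1 ( *%R (y * x)) r1; lra.
rewrite maxxx subr0.
(* The two cases tell whether the second tent has already reached zero at [y], that is, whether
   [x * r <= y]. *)
case: ifPn => h.
  have -> : Num.max 0 (x * r - y) = 0.
    by apply/max_idPl; rewrite er pmulr_rle0 // subr_le0.
  by rewrite mulr0 subr0; apply/max_idPr; rewrite mulr_ge0 ?ltW.
have -> : Num.max 0 (x * r - y) = x * r - y.
  by apply/max_idPr; rewrite er pmulr_rge0 // subr_ge0 ltW // ltNge.
have -> : x * y - q * x * (x * r - y) = x / y * (y - x).
  by rewrite er /q /r; field; rewrite !gt_eqF.
by apply/max_idPr; rewrite mulr_ge0 ?divr_ge0 ?subr_ge0 // ltW.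
Qed.

(** Tents ending at 1 with peaks at [y] and at [x] turn all the inequalities behind the third bound
    into equalities. The value at [(y, x)] is [x + y - 1], nonnegative in this region. *)
Lemma asym_attained_high (x y : R) : 0 < x -> x <= y -> 1 - y <= x -> y <= 1 ->
  exists2 C, reflected_maxmin R C & C x y - C y x = (1 - y) / y * (y - x).
Proof.
move=> xp xy yx1 y1.
have yp := lt_le_trans xp xy; have x1 := le_trans xy y1.
pose q := (1 - y) / y; pose p := (1 - x) / x.
have qy : q * y = 1 - y by rewrite divfK // gt_eqF.
have px : p * x = 1 - x by rewrite divfK // gt_eqF.
have q0 : 0 <= q by rewrite divr_ge0 ?subr_ge0 // ltW.
have p0 : 0 <= p by rewrite divr_ge0 ?subr_ge0 // ltW.
exists (maxmin_fun (tent q 1) (tent p 1)).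
  by apply: maxmin_fun_reflected; exact: in_F_tent.
have -> : (1 - y) / y = q by [].
have fx : tent q 1 x = q * x.
  apply: tentl; first by rewrite mulr_ge0 // ltW.
  by have := ler_wpM2l q0 xy; lra.
have fy : tent q 1 y = 1 - y by rewrite tentl ?qy //; lra.
have gx : tent p 1 x = 1 - x by rewrite tentl ?px //; lra.
have gy : tent p 1 y = 1 - y.
  rewrite tentr; first by apply/max_idPr; lra.
  by have := ler_wpM2l p0 xy; lra.
have qy1 : q <= 1 by rewrite ler_pdivrMr //; lra.
rewrite /maxmin_fun fx fy gx gy.
have -> : Num.max 0 (y * x - (1 - y) * (1 - x)) = y * x - (1 - y) * (1 - x).
  by apply/max_idPr; lra.
have -> : Num.max 0 (x * y - q * x * (1 - y)) = x * y - q * x * (1 - y).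
  apply/max_idPr.
  have h : q * (1 - y) <= 1 * y by apply: ler_pM => //; lra.
  by have := ler_wpM2l (ltW xp) h; lra.
by have := congr1 ( *%R^~ (1 - x)) qy; rewrite /=; lra.
Qed.

(** * The maximal asymmetry function *)

Lemma dstar_eq_max (C : R -> R -> R) (x y m : R) : reflected_maxmin R C ->
  0 <= m -> C x y - C y x = m ->
  (forall D, reflected_maxmin R D -> `|D x y - D y x| <= m) ->
  dstar (reflected_maxmin R) x y = m.
Proof.
move=> MC m0 Cm Hm; apply: sup_eq_max.
  by exists C => //; rewrite Cm ger0_norm.
by move=> _ [D MD <-]; exact: Hm.
Qed.

Lemma dstarC (M : set (R -> R -> R)) (x y : R) : dstar M x y = dstar M y x.
Proof.
by rewrite /dstar; congr sup; apply: eq_imagel => C _; rewrite distrC.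
Qed.

Lemma dstar_0y (y : R) :
  0 <= y -> y <= 1 -> dstar (reflected_maxmin R) 0 y = 0.
Proof.
move=> y0 y1.
have uy : unit_itv y by rewrite unit_itvE y0.
have z C : reflected_maxmin R C -> C 0 y - C y 0 = 0.
  by move=> [cC _]; rewrite (copula_0y cC uy) (copula_x0 cC uy) subrr.
(* This tent is the zero function; it provides a member of the class at which the supremum is
   taken. *)
have F0 : in_F (tent 0 (0 : R)) by exact: in_F_tent.
apply: (dstar_eq_max (maxmin_fun_reflected F0 F0)) => //.
  by apply: z; exact: maxmin_fun_reflected.
by move=> D MD; rewrite z // normr0.
Qed.

Lemma dstar_le (x y : R) : 0 <= x -> x <= y -> y <= 1 ->
  [/\ (y * (1 - y) <= x -> x <= 1 - y ->
         dstar (reflected_maxmin R) x y = x / y * (y - x)),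
      (1 - y <= x -> dstar (reflected_maxmin R) x y = (1 - y) / y * (y - x)) &
      (x <= y * (1 - y) -> dstar (reflected_maxmin R) x y = x * y)].
Proof.
rewrite le_eqVlt => /predU1P[<- y0 y1|xp xy y1].
  (* The edge [x = 0] includes the origin, where [x / y] is 0 as well. On this edge the second case
     forces [y = 1]. *)
  rewrite dstar_0y // !mul0r subr0; split=> // h.
  have -> : y = 1 by lra.
  by rewrite subrr !mul0r.
have yp := lt_le_trans xp xy.
have ub D := @reflected_asym_le D x y ^~ (ltW xp).
have d0 : 0 <= y - x by rewrite subr_ge0.
split.
- move=> h1 h2; have [C MC CE] := asym_attained_low xp xy h2.
  apply: (dstar_eq_max MC); first by rewrite mulr_ge0 // divr_ge0 // ltW.
    rewrite CE; case: ifPn => // h3.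
    (* The regions overlap only on this curve, where both formulas give [x * y]. *)
    have -> : x = y * (1 - y) by apply/eqP; rewrite eq_le h3.
    by field; rewrite gt_eqF.
  by move=> D MD; have [] := ub D MD xy yp y1.
- move=> h1; have [C MC CE] := asym_attained_high xp xy h1 y1.
  apply: (dstar_eq_max MC) => //.
    by rewrite mulr_ge0 // divr_ge0 ?subr_ge0 // ltW.
  by move=> D MD; have [] := ub D MD xy yp y1.
- move=> h1.
  have h2 : x <= 1 - y.
    by apply: (le_trans h1); rewrite ler_piMl // subr_ge0.
  have [C MC CE] := asym_attained_low xp xy h2.
  apply: (dstar_eq_max MC); first by rewrite mulr_ge0 // ltW.
    by rewrite CE h1.
  by move=> D MD; have [] := ub D MD xy yp y1.
Qed.

(** * The global bound and its attainment *)

Lemma sqrt2_facts : [/\ 1 < Num.sqrt 2 :> R, Num.sqrt 2 < 3 / 2 :> R &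
  Num.sqrt 2 * Num.sqrt 2 = 2 :> R].
Proof.
have s2 : Num.sqrt 2 * Num.sqrt 2 = 2 :> R by rewrite -expr2 sqr_sqrtr.
have s0 : 0 <= Num.sqrt 2 :> R := sqrtr_ge0 _.
by split=> //; rewrite ltNge; apply/negP => h; nra.
Qed.

Lemma reflected_asym_le_sqrt (C : R -> R -> R) (x y : R) :
  reflected_maxmin R C -> unit_itv x -> unit_itv y ->
  `|C x y - C y x| <= 3 - 2 * Num.sqrt 2.
Proof.
move=> MC; wlog xy : x y / x <= y.
  move=> H ux uy; have [xy|yx] := leP x y; first exact: H.
  by rewrite distrC; apply: H => //; exact: ltW.
rewrite !unit_itvE => /andP[x0 x1] /andP[y0 y1].
have [s1 s2 ss] := sqrt2_facts.
set s := Num.sqrt 2 in s1 s2 ss *.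
have [y00|yp] := leP y 0.
  have -> : x = y by lra.
  by rewrite subrr normr0; lra.
have amgm u : (1 - u) * (2 * u - 1) <= (3 - 2 * s) * u.
  have := sqr_ge0 (s * u - 1).
  have -> : (s * u - 1) ^+ 2 = s * s * (u * u) - 2 * (s * u) + 1 by ring.
  by rewrite ss; lra.
have [_ B1 B2] := reflected_asym_le MC x0 xy yp y1.
have [h|h] := leP x (1 - y).
  apply: (le_trans B1); rewrite mulrAC ler_pdivrMr //.
  (* The goal reads [(x - k) * y <= x * x] with [k = 3 - 2 * s]. It is clear for [x <= k]; otherwise
     the worst case is [y = 1 - x], where it becomes [amgm] at [u = 1 - x]. *)
  have [k|k] := leP x (3 - 2 * s).
    have := mulr_ge0 x0 x0.
    have := mulr_ge0 y0 (_ : 0 <= 3 - 2 * s - x).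
    by rewrite subr_ge0 => /(_ k); lra.
  have := mulr_ge0 (_ : 0 <= 1 - y - x) (_ : 0 <= x - (3 - 2 * s)).
  rewrite !subr_ge0 => /(_ h (ltW k)).
  by have := amgm (1 - x); lra.
apply: (le_trans B2); rewrite mulrAC ler_pdivrMr //.
(* Since [x >= 1 - y], the factor [y - x] is at most [2 * y - 1]. *)
apply: le_trans (amgm y).
by apply: ler_wpM2l; lra.
Qed.

Lemma mu_infty_le_sqrt (C : R -> R -> R) :
  reflected_maxmin R C -> mu_infty C <= 3 - 2 * Num.sqrt 2.
Proof.
move=> MC; have [[x [y [ux uy ->]]] _] := mu_infty_max MC.1.
exact: reflected_asym_le_sqrt.
Qed.

Lemma mu_infty_attained :
  exists2 C, reflected_maxmin R C & mu_infty C = 3 - 2 * Num.sqrt 2.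
Proof.
have [s1 s2 ss] := sqrt2_facts.
(* This [y] gives equality in the AM-GM step, and [x = 1 - y] gives equality in
   [y - x <= 2 * y - 1]. *)
pose y : R := Num.sqrt 2 / 2; pose x : R := 1 - y.
have yp : 0 < y by rewrite /y; lra.
have xp : 0 < x by rewrite /x /y; lra.
have xy : x <= y by rewrite /x /y; lra.
have y1 : y <= 1 by rewrite /y; lra.
have [C MC CE] := asym_attained_high xp xy (lexx _) y1.
exists C => //; apply/eqP; rewrite eq_le mu_infty_le_sqrt //=.
have ux : unit_itv x by rewrite unit_itvE ltW //= (le_trans xy).
have uy : unit_itv y by rewrite unit_itvE ltW.
apply: le_trans ((mu_infty_max MC.1).2 x y ux uy).
apply: le_trans (ler_norm _).
rewrite CE mulrAC ler_pdivlMr // /x /y; lra.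
Qed.

End Copula.

Theorem theorem6p3 (R : realType) :
  [/\ (forall C : R -> R -> R, reflected_maxmin R C ->
         mu_infty C <= 3 - 2 * Num.sqrt 2),
      (exists2 C : R -> R -> R, reflected_maxmin R C &
         mu_infty C = 3 - 2 * Num.sqrt 2),
      mu_infty_class (reflected_maxmin R) = 3 - 2 * Num.sqrt 2 &
      forall x y : R, unit_itv x -> unit_itv y ->
        [/\ (y * (1 - y) <= x -> x <= Num.min y (1 - y) ->
               dstar (reflected_maxmin R) x y = x / y * (y - x)),
            (1 - y <= x -> x <= y ->
               dstar (reflected_maxmin R) x y = (1 - y) / y * (y - x)),
            (x <= y * (1 - y) \/ y <= x * (1 - x) ->
               dstar (reflected_maxmin R) x y = x * y),
            (x * (1 - x) <= y -> y <= Num.min x (1 - x) ->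
               dstar (reflected_maxmin R) x y = y / x * (x - y)) &
            (1 - x <= y -> y <= x ->
               dstar (reflected_maxmin R) x y = (1 - x) / x * (x - y))]].
Proof.
split.
- exact: mu_infty_le_sqrt.
- exact: mu_infty_attained.
- apply: sup_eq_max; first by have [C MC CE] := mu_infty_attained R; exists C.
  by move=> _ [C MC <-]; exact: mu_infty_le_sqrt.
move=> x y; rewrite !unit_itvE => /andP[x0 x1] /andP[y0 y1]; split.
- rewrite le_min => h1 /andP[xy h2].
  by have [H _ _] := dstar_le x0 xy y1; exact: H.
- by move=> h1 xy; have [_ H _] := dstar_le x0 xy y1; exact: H.
- case=> h.
    have xy : x <= y by apply: (le_trans h); rewrite ler_piMr //; lra.
    by have [_ _ H] := dstar_le x0 xy y1; exact: H.
  have yx : y <= x by apply: (le_trans h); rewrite ler_piMr //; lra.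
  by rewrite dstarC mulrC; have [_ _ H] := dstar_le y0 yx x1; exact: H.
- rewrite le_min dstarC => h1 /andP[yx h2].
  by have [H _ _] := dstar_le y0 yx x1; exact: H.
- by move=> h1 yx; rewrite dstarC; have [_ H _] := dstar_le y0 yx x1; exact: H.
Qed.
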